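(* Assume that $\operatorname{cov}(\mathcal{M})=\mathfrak{b}=\mathfrak{d}$. Then there exists a subgroup $G$ of a $\sigma$-compact subgroup of $\mathbb{Z}^{\mathbb{N}}$ such that all finite powers $G^k$ of $G$ are Rothberger-bounded (and Hurewicz-bounded), but $G$ does not have the Menger property.
   Context: For $f,g\in\mathbb{N}^{\mathbb{N}}$, $f\le^* g$ means $f(n)\le g(n)$ for all but finitely many $n$. $\mathfrak{b}$ is the minimal cardinality of a $\le^*$-unbounded subset of $\mathbb{N}^{\mathbb{N}}$; $\mathfrak{d}$ is the minimal cardinality of a dominating $D\subseteq\mathbb{N}^{\mathbb{N}}$ (for each $g\in\mathbb{N}^{\mathbb{N}}$ there is $f\in D$ with $g\le^* f$); $\operatorname{cov}(\mathcal{M})$ is the minimal cardinality of a cover of $\mathbb{R}$ by meager sets, equivalently, of $Y\subseteq\mathbb{N}^{\mathbb{N}}$ such that there is no $f\in\mathbb{N}^{\mathbb{N}}$ with the property that for each $y\in Y$, $f(n)=y(n)$ for some $n$. The group $\mathbb{Z}^{\mathbb{N}}$ carries pointwise addition and the product topology ($\mathbb{Z}$ discrete); subgroups carry the subspace topology, and finite powers the product group structure and topology. $\sigma$-compact means a union of countably many compact sets. For a topological group $(G,\cdot)$, with the condition required for each sequence $(U_n)_{n\in\mathbb{N}}$ of neighborhoods of the unit: $G$ is Rothberger-bounded if there exist $a_n\in G$ such that $G=\bigcup_n a_n\cdot U_n$; Hurewicz-bounded if there exist finite $F_n\subseteq G$ such that each $g\in G$ belongs to $F_n\cdot U_n$ for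 all but finitely many $n$. A topological space $X$ has the Menger property if for each sequence $(\mathcal{U}_n)_{n\in\mathbb{N}}$ of open covers of $X$ there exist finite $\mathcal{F}_n\subseteq\mathcal{U}_n$ such that $\bigcup_n\mathcal{F}_n$ is a cover of $X$. *)

(* Defs.v *)
From HB Require Import structures.
From mathcomp Require Import all_boot all_order all_algebra.
From mathcomp Require Import all_classical all_reals all_analysis.

Set Implicit Arguments.
Unset Strict Implicit.
Unset Printing Implicit Defensive.

Import Order.TTheory GRing.Theory Num.Theory.
Import numFieldNormedType.Exports.

Local Open Scope classical_set_scope.
Local Open Scope card_scope.
Local Open Scope ring_scope.

HB.instance Definition _ := hasNbhs.Build int principal_filter.
HB.instance Definition _ := Discrete_ofNbhs.Build int erefl.

Section discrete_int.
Let int_sub_continuous : continuous (fun x : int * int => x.1 - x.2).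
Proof.
move=> x A /nbhs_singleton Ax.
exists ([set x.1], [set x.2]).
  by split => /=; rewrite nbhs_principalE; apply/principal_filterP.
by move=> [a b] [/= -> ->].
Qed.
HB.instance Definition _ :=
  PreTopologicalNmodule_isTopologicalZmodule.Build int int_sub_continuous.
End discrete_int.

Section ptws_zmodule.
Variables (I : Type) (V : topologicalZmodType).
HB.instance Definition _ := GRing.Zmodule.copy {ptws I -> V} (I -> V).

Let ptws_sub_continuous :
  continuous (fun x : {ptws I -> V} * {ptws I -> V} => x.1 - x.2).
Proof.
have subi i : continuous
    (fun x : {ptws I -> V} * {ptws I -> V} => x.1 i - x.2 i).
  move=> x; have proj_cvg (y : {ptws I -> V}) :
      (fun f : {ptws I -> V} => f i) @ y --> y i.
    have /cvg_sup/(_ i) yi : y --> y by exact: cvg_id.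
    apply: cvg_trans (@initial_continuous _ _ (fun f : I -> V => f i) y).
    exact: cvg_app.
  apply: (@continuous_comp _ _ _
    (fun x : {ptws I -> V} * {ptws I -> V} => (x.1 i, x.2 i))
    (fun p : V * V => p.1 - p.2)); last exact: sub_continuous.
  by apply: cvg_pair => /=; apply: cvg_comp (proj_cvg _);
    [exact: cvg_fst|exact: cvg_snd].
move=> x; apply/cvg_sup => i U [/= _ [[B oB <-] /= Bx sBU]].
by apply: filterS sBU _; apply: (subi i x); exact: open_nbhs_nbhs.
Qed.
HB.instance Definition _ :=
  PreTopologicalNmodule_isTopologicalZmodule.Build {ptws I -> V}
    ptws_sub_continuous.
End ptws_zmodule.

Section subgroup.
Variables (V : topologicalZmodType) (G : zmodClosed V).

Definition subgroup : Type := {x : V | x \in G}.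

HB.instance Definition _ := [isSub of subgroup for @sval V (fun x => x \in G)].
HB.instance Definition _ := [Choice of subgroup by <:].
HB.instance Definition _ := [SubChoice_isSubZmodule of subgroup by <:].
HB.instance Definition _ :=
  Topological.copy subgroup (initial_topology (val : subgroup -> V)).

Let subgroup_sub_continuous :
  continuous (fun x : subgroup * subgroup => x.1 - x.2).
Proof.
have val_continuous : continuous (val : subgroup -> V).
  exact: (@initial_continuous _ _ (val : subgroup -> V)).
apply: (@continuous_comp_initial _ _ _ (val : subgroup -> V)) => x.
apply: (@continuous_comp _ _ _
  (fun x : subgroup * subgroup => (val x.1, val x.2))
  (fun p : V * V => p.1 - p.2)); last exact: sub_continuous.
apply: cvg_pair => /=.
- by apply: cvg_comp; [exact: cvg_fst|exact: val_continuous].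
- by apply: cvg_comp; [exact: cvg_snd|exact: val_continuous].
Qed.
HB.instance Definition _ :=
  PreTopologicalNmodule_isTopologicalZmodule.Build subgroup
    subgroup_sub_continuous.
End subgroup.

Section covering_properties.

(* The group law is written additively, as is customary for `zmodType`. *)
Definition rothberger_bounded (G : topologicalZmodType) :=
  forall U : nat -> set G, (forall n, nbhs 0 (U n)) ->
  exists a : nat -> G, [set: G] = \bigcup_n [set a n + u | u in U n].

Definition hurewicz_bounded (G : topologicalZmodType) :=
  forall U : nat -> set G, (forall n, nbhs 0 (U n)) ->
  exists F : nat -> set G, (forall n, finite_set (F n)) /\
    forall g, \forall n \near \oo, [set a + u | a in F n & u in U n] g.

Definition open_cover (X : topologicalType) (U : set (set X)) :=
  (forall V, U V -> open V) /\ \bigcup_(V in U) V = [set: X].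

Definition menger (X : topologicalType) :=
  forall U : nat -> set (set X), (forall n, open_cover (U n)) ->
  exists F : nat -> set (set X),
    (forall n, finite_set (F n) /\ F n `<=` U n) /\
    \bigcup_n \bigcup_(V in F n) V = [set: X].

Definition sigma_compact (X : topologicalType) (A : set X) :=
  exists K : nat -> set X, (forall n, compact (K n)) /\ A = \bigcup_n K n.

Definition nowhere_dense (X : topologicalType) (A : set X) :=
  (closure A)° = set0.

Definition meager (X : topologicalType) (A : set X) :=
  exists F : nat -> set X,
    (forall n, nowhere_dense (F n)) /\ A = \bigcup_n F n.

End covering_properties.

Section cardinal_characteristics.

(* The library has no type of cardinals, only the comparisons `#<=` and `#=`.
   A cardinal characteristic min {|A| : P A} is represented by the family P;
   the minimum is realized by those members of P that inject into all members
   of P. The families for b, d and cov(M) are `unbounded_families`,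
   `dominating_families` and `meager_covers` below. *)
Definition realizes_min_card T (P : set (set T)) (A : set T) :=
  P A /\ forall B, P B -> A #<= B.

Definition same_min_card T U (P : set (set T)) (Q : set (set U)) :=
  exists A B, [/\ realizes_min_card P A, realizes_min_card Q B & A #= B].

Definition le_star (f g : nat -> nat) := \forall n \near \oo, (f n <= g n)%N.

Definition unbounded_families : set (set (nat -> nat)) :=
  [set B | ~ exists g, forall f, B f -> le_star f g].

Definition dominating_families : set (set (nat -> nat)) :=
  [set D | forall g, exists2 f, D f & le_star g f].

Definition meager_covers (R : realType) : set (set (set R)) :=
  [set C | (forall M, C M -> meager M) /\ \bigcup_(M in C) M = [set: R]].

End cardinal_characteristics.

(* Main.v *)
(** Let kappa = cov(M) = b = d. By recursion on kappa one builds points x_b of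
   {0,1}^N whose supports are sparse: consecutive elements a < a' of the support
   of x_b satisfy E_b(a) < a', where E_b eventually dominates the b-th function
   of a dominating family and fewer than kappa functions computed from the
   earlier points. G is the subgroup of Z^N generated by the x_b; it lies in the
   sigma-compact group of bounded sequences, so its powers are Hurewicz-bounded.

   Finitely many sparse supports have common gaps, longer than any function
   dominated by their E_b. Hence a nonzero z in G has infinite support: in a gap
   common to its later generators, the earliest one still has a point. So
   "two points of the support lie in [n, m)" yields open covers of G, and these
   defeat the Menger property because the E_b are dominating.

   For G^k Rothberger-bounded, fix a modulus m, occurring at stage c. There are
   fewer than kappa = cov(M) = b tuples of points x_b with b < c, so one sequence
   guesses all their restrictions to [0, m_n), and the position of a correct
   guess is bounded by a single function. The remaining generators vanish on a
   common gap longer than that bound, so only their values before the gap have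
   to be guessed, and these form finitely many patterns. *)
Require Import Defs.
From HB Require Import structures.
From mathcomp Require Import all_boot all_order all_algebra.
From mathcomp Require Import all_classical all_reals all_analysis.
From mathcomp Require Import zify lra.
From mathcomp Require wochoice.

Set Implicit Arguments.
Unset Strict Implicit.
Unset Printing Implicit Defensive.

Import Order.TTheory GRing.Theory Num.Theory.
Import numFieldNormedType.Exports.

Local Open Scope classical_set_scope.
Local Open Scope card_scope.
Local Open Scope ring_scope.

(** * Thin subsets of N *)

Section thin_sets.
Local Open Scope nat_scope.

(** A monotone majorant of both [h] and the identity, so that its iterates can be compared. *)
Definition nondec_hull (h : nat -> nat) (q : nat) : nat := q + \sum_(i < q.+1) h i.

(** Diagonal over the iterates: for [a >= r] it is at least the [r]-th iterate at [a.+1], so gaps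
    longer than this one function yield [thin]. *)
Definition iter_hull (h : nat -> nat) (a : nat) : nat := iter a (nondec_hull h) a.+1.

(** Every number [r] of iterations is allowed, because each further set in [common_gap] doubles the
    number needed. *)
Definition thin (h : nat -> nat) (A : nat -> bool) := forall r,
  \forall a \near \oo, A a -> forall b, a < b < iter r (nondec_hull h) a.+1 -> ~~ A b.

Lemma nondec_hull_id h q : q <= nondec_hull h q.
Proof. exact: leq_addr. Qed.

Lemma nondec_hull_ge h i q : i <= q -> h i <= nondec_hull h q.
Proof.
move=> iq; rewrite /nondec_hull (bigD1 (Ordinal (iq : i < q.+1)))//=.
lia.
Qed.

Lemma nondec_hull_mono h : {homo nondec_hull h : p q / p <= q}.
Proof.
move=> p q pq; rewrite /nondec_hull leq_add// -!(big_mkord xpredT).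
rewrite (big_cat_nat (n := p.+1) (p := q.+1))//=.
lia.
Qed.

Lemma iter_nondec_hull_mono h r : {homo iter r (nondec_hull h) : p q / p <= q}.
Proof. by elim: r => //= r IH p q /IH; apply: nondec_hull_mono. Qed.

Lemma iter_nondec_hull_leq h r s p :
  r <= s -> iter r (nondec_hull h) p <= iter s (nondec_hull h) p.
Proof.
move=> /subnK <-; rewrite iterD; elim: (s - r) => //= t IH.
exact: leq_trans IH (nondec_hull_id _ _).
Qed.

Lemma iter_hull_ge h : le_star h (iter_hull h).
Proof.
(* At [a = 0] nothing is iterated and [h] does not enter, hence the threshold 1. *)
exists 1 => // -[//|a] _; rewrite /iter_hull.
apply: leq_trans (iter_nondec_hull_leq h a.+2 (isT : 1 <= a.+1)) => /=.
exact: nondec_hull_ge.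
Qed.

Lemma thin_iter_hull h (E : nat -> nat) (A : nat -> bool) :
  (forall a b, A a -> A b -> a < b -> E a < b) -> le_star (iter_hull h) E ->
  thin h A.
Proof.
move=> spA [N _ hE] r; exists (maxn N r) => // a /=.
rewrite geq_max => /andP[Na ra] Aa b /andP[ab br].
apply/negP => Ab; have Eb := spA _ _ Aa Ab ab.
have := hE a Na; have := iter_nondec_hull_leq h a.+1 ra; rewrite /iter_hull.
lia.
Qed.

(* If A has a point a in the gap found for the other sets, A has no further point
   on a long interval after a; the gap is asked for twice as many iterations, so
   that its part after a is still long enough. *)
Lemma common_gap h (L : seq (nat -> bool)) : (forall A, A \in L -> thin h A) ->
  forall r N, exists2 q, N <= q & forall A, A \in L ->
    forall b, q <= b < iter r (nondec_hull h) q -> ~~ A b.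
Proof.
elim: L => [_ r N|A L IH thL r N]; first by exists N.
have [M _ MA] := thL A (mem_head _ _) r.
have thL' B : B \in L -> thin h B by move=> BL; apply: thL; rewrite inE BL orbT.
have [q] := IH thL' (r + r) (maxn N M).
rewrite geq_max => /andP[Nq Mq]; rewrite iterD => gapL.
have [gapA|] := pselect (forall b, q <= b < iter r (nondec_hull h) q -> ~~ A b).
  exists q => // B; rewrite inE => /predU1P[->//|BL] b /andP[qb bq].
  apply: gapL BL _ _; rewrite qb (leq_trans bq)//.
  exact: (iter_nondec_hull_leq h _ (leq0n r)).
move=> /existsNP[a] /not_implyP[/andP[qa aq] /negP]; rewrite negbK => Aa.
exists a.+1; first by rewrite ltnW// ltnS (leq_trans Nq).
move=> B; rewrite inE => /predU1P[->|BL] b /andP[ab br].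
  by apply: MA Aa _ _; [exact: leq_trans Mq qa|rewrite ab].
apply: gapL BL _ _; rewrite (leq_trans qa (ltnW ab))/=.
by apply: leq_trans br _; apply: iter_nondec_hull_mono.
Qed.

(** The orbit of 0 under [a + E a + 1]. Starting at 0 makes each generator nonzero at coordinate 0,
    which the covers in [not_menger_subgroup] test. *)
Lemma sparse_subset (E : nat -> nat) : exists A : nat -> bool,
  [/\ A 0, forall n, exists2 a, n <= a & A a &
      forall a b, A a -> A b -> a < b -> E a < b].
Proof.
pose u n := iter n (fun a => (a + E a).+1) 0.
have uS n : u n.+1 = (u n + E (u n)).+1 by [].
have umono : {homo u : m n / m < n}.
  by apply: homo_ltn => [?|n]; [exact: ltn_trans|rewrite uS ltnS leq_addr].
have ule : {homo u : m n / m <= n} by exact: ltnW_homo.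
exists (fun a => `[< exists n, u n = a >]); split.
- by apply/asboolP; exists 0.
- move=> n; exists (u n); last by apply/asboolP; exists n.
  by elim: n => // n IH; rewrite uS ltnS (leq_trans IH) ?leq_addr.
- move=> _ _ /asboolP[m <-] /asboolP[n <-] mn.
  have {}mn : m < n.
    by rewrite ltnNge; apply: contraTN mn => /ule; rewrite -leqNgt.
  by apply: leq_trans (ule _ _ mn); rewrite uS ltnS leq_addl.
Qed.

End thin_sets.

(** * Guessing fewer than kappa sequences *)

Section guessing.
Local Open Scope nat_scope.

(* D has cardinality kappa; a set is small when its cardinality is below kappa. *)
Variable D : set (nat -> nat).
Local Notation small S := (~ (D #<= S)).

Lemma small_image T U (f : T -> U) (S : set T) : small S -> small (f @` S).
Proof. by move=> smS DfS; apply/smS/(card_le_trans DfS)/card_image_le. Qed.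

Hypothesis small_bounded : forall F, small F ->
  exists g, forall f, F f -> le_star f g.
Hypothesis small_guessed : forall F, small F ->
  exists g : nat -> nat, forall f, F f -> forall N, exists2 n, N <= n & g n = f n.

(* Codes pairs: [logn 2] takes every value infinitely often. *)
Definition odd_part_index l n := 2 ^ l * n.*2.+1.

Lemma logn_odd_part_index l n : logn 2 (odd_part_index l n) = l.
Proof.
rewrite /odd_part_index lognM ?expn_gt0// pfactorK// lognE/= dvdn2.
by rewrite /= odd_double addn0.
Qed.

Lemma odd_part_indexK l n : (odd_part_index l n %/ 2 ^ l)./2 = n.
Proof. by rewrite /odd_part_index mulKn ?expn_gt0//= uphalf_double. Qed.

Lemma odd_part_index_ge l n : n <= odd_part_index l n.
Proof.
rewrite /odd_part_index; have : 0 < 2 ^ l by rewrite expn_gt0.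
nia.
Qed.

Lemma take_mkseq T (y : nat -> T) i j : i <= j -> take i (mkseq y j) = mkseq y i.
Proof. by move=> ij; rewrite /mkseq -map_take take_iota (minn_idPl ij). Qed.

Lemma block_index (u : nat -> nat) : {homo u : i j / i < j} ->
  exists blk : nat -> nat, forall j n, u j <= n < u j.+1 -> blk n = j.
Proof.
move=> umono; have ule : {homo u : i j / i <= j} by exact: ltnW_homo.
exists (fun n => xget 0 [set j | u j <= n < u j.+1]) => j n jn.
case: xgetP => [i _ /= /andP[ui iu]|/(_ j)//].
case/andP: jn => uj ju; apply/eqP; rewrite eqn_leq; apply/andP; split.
  by rewrite leqNgt; apply/negP => /ule; lia.
by rewrite leqNgt; apply/negP => /ule; lia.
Qed.

(* The tuple length increases by one as follows: N is cut into blocks [u j, u j.+1)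
   almost all of which contain a correct guess of the shorter tuple, and the new
   entry is guessed on whole blocks at once. This needs no bound on the number of
   pairs. The free parameter s, of which all values up to p must occur, will
   carry the finite pattern of the generators outside S. *)
Lemma guess_tuples (S : set (nat -> bool)) (m : nat -> nat) l : small S ->
  exists (f : nat -> nat * seq (seq bool)) (h : nat -> nat),
  forall L : seq (nat -> bool), size L = l -> (forall y, y \in L -> S y) ->
  \forall p \near \oo, forall s, s <= p ->
    exists n, p <= n < h p /\ f n = (s, [seq mkseq y (m n) | y <- L]).
Proof.
move=> smS; elim: l => [|l [f [h0 fP]]].
  exists (fun n => (logn 2 n, [::])), (fun p => (odd_part_index p p).+1).
  move=> [|//] _ _; exists 0 => // p _ s sp; exists (odd_part_index s p).
  rewrite logn_odd_part_index odd_part_index_ge ltnS; split=> //=.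
  by rewrite /odd_part_index leq_mul2r leq_exp2l// sp orbT.
(* Block [j] contains [[u j, h0 (u j))], where the shorter tuple is guessed; [p.+1] keeps the blocks
   nonempty. *)
pose h p := maxn (h0 p) p.+1; pose u j := iter j h 0.
have umono : {homo u : i j / i < j}.
  by apply: homo_ltn => [?|n]; [exact: ltn_trans|rewrite /= leq_maxr].
have u_ge j : j <= u j.
  by elim: j => // j IH; apply: leq_ltn_trans IH _; apply: umono.
have [blk blkP] := block_index umono.
have [dec decK] : exists dec : nat -> seq bool, cancel pickle dec.
  by exists (fun c => odflt [::] (unpickle c)) => t; rewrite pickleK.
(* The largest modulus up to the end of block [j]: a correct guess of [y] below [M j] restricts to
   every modulus of the block. *)
pose M j := \max_(n < u j.+1) m n.
have [g gP] := small_guessed (small_image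
  (f := fun (y : nat -> bool) j => pickle (mkseq y (M j))) smS).
have /choice[k kP] : forall yp : (nat -> bool) * nat, exists j, S yp.1 ->
    yp.2 <= j /\ g j = pickle (mkseq yp.1 (M j)).
  move=> [y p]; have [Sy|nSy] := pselect (S y); last by exists 0.
  have [j pj gj] := gP (fun j => pickle (mkseq y (M j))) (ex_intro2 _ _ y Sy erefl) p.
  by exists j.
have [h' h'P] := small_bounded (small_image
  (f := fun y p => u (k (y, p)).+1) smS).
exists (fun n => ((f n).1,
  take (m n) (dec (g (blk n))) :: (f n).2)), h'.
move=> [//|y L] [sL] LS; have Sy : S y by apply: LS; rewrite mem_head.
have [N1 _ H1] := h'P _ (ex_intro2 _ _ y Sy erefl).
have [N2 _ H2] : \forall p \near \oo, forall s, s <= p ->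
    exists n, p <= n < h0 p /\ f n = (s, [seq mkseq y (m n) | y <- L]).
  by apply: fP => // z zL; apply: LS; rewrite inE zL orbT.
exists (maxn N1 N2) => // p /=; rewrite geq_max => /andP[N1p N2p] s sp.
have [/= pj gj] := kP (y, p) Sy; set j := k (y, p) in pj gj.
have pu : p <= u j by exact: leq_trans pj (u_ge j).
have [n [/andP[un nh] fn]] := H2 (u j) (leq_trans N2p pu) s (leq_trans sp pu).
have nu : n < u j.+1 by apply: leq_trans nh _; rewrite /= leq_maxl.
exists n; split.
  by rewrite (leq_trans pu un) (leq_trans nu)//; exact: H1.
rewrite fn (blkP j) ?un// gj decK take_mkseq//.
exact: (leq_bigmax (Ordinal nu)).
Qed.

(** Tuple lengths are interleaved along [odd_part_index]. The summand [w2] bounds the modulus at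
    each position where a guess is promised for [s <= pb q] and length at most [q]. *)
Lemma stage_function (S : set (nat -> bool)) (next : (nat -> bool) -> nat -> nat)
    (d pb : nat -> nat) : (forall q, q <= pb q) -> small S ->
  exists w : nat -> nat, [/\ le_star d w,
    forall y, S y -> le_star (iter_hull (next y)) w &
    exists F : nat -> nat * seq (seq bool),
      forall L : seq (nat -> bool), (forall y, y \in L -> S y) ->
      \forall q \near \oo, forall s, s <= pb q ->
      exists n, [/\ q <= n, F n = (s, [seq mkseq y (d n) | y <- L]) & d n <= w q]].
Proof.
move=> pb_ge smS.
have [w1 w1P] := small_bounded (small_image (f := iter_hull \o next) smS).
have /choice[f /choice[h fP]] := fun l => guess_tuples (d \o odd_part_index l) l smS.
pose w2 q := \max_(l < q.+1) \max_(n < h l (pb q)) d (odd_part_index l n).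
exists (fun q => d q + w1 q + w2 q); split.
- by exists 0 => // n _; rewrite -addnA leq_addr.
- move=> y Sy; have [N _ HN] := w1P _ (ex_intro2 _ _ y Sy erefl).
  exists N => // n /HN /= nxw; rewrite addnAC addnC.
  exact: leq_trans nxw (leq_addr _ _).
exists (fun i => let l := logn 2 i in f l (i %/ 2 ^ l)./2) => L LS.
have [N _ HN] := fP (size L) L erefl LS.
exists (maxn N (size L)) => // q /=; rewrite geq_max => /andP[Nq Lq] s sp.
have [n [/andP[pn nh] fn]] := HN (pb q) (leq_trans Nq (pb_ge q)) s sp.
exists (odd_part_index (size L) n); split.
- exact: leq_trans (leq_trans (pb_ge q) pn) (odd_part_index_ge _ _).
- by rewrite logn_odd_part_index odd_part_indexK fn.
- apply: leq_trans (leq_addl _ _).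
  apply: leq_trans (leq_bigmax (Ordinal (Lq : size L < q.+1))).
  exact: (leq_bigmax (Ordinal nh)).
Qed.

End guessing.

(** * The transfinite construction of the generators *)

Lemma strict_well_order (T : eqType) : exists lt : rel T,
  [/\ irreflexive lt, transitive lt, forall a b, a != b -> lt a b || lt b a &
      forall A : set T, A !=set0 ->
        exists2 a, A a & forall b, A b -> b != a -> lt a b].
Proof.
have [r r_wo] := wochoice.well_ordering_principle T.
have rT : wochoice.wo_chain r predT by move=> A _; exact: r_wo.
have r_anti a b : r a b -> r b a -> a = b.
  by move=> ab ba; apply: (wochoice.wo_chain_antisymmetric rT) => //; rewrite ab ba.
have r_total a b : r a b || r b a by exact: (wochoice.wo_chainW rT).
have r_min (A : set T) : A !=set0 -> exists2 a, A a & forall b, A b -> r a b.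
  move=> [a0 Aa0]; have [|a [[/asboolP Aa lb] _]] := r_wo (fun a => `[< A a >]).
    by exists a0; apply/asboolP.
  by exists a => // b Ab; apply: lb; apply/asboolP.
have r_trans : transitive r.
  move=> b a c ab bc.
  (* Transitivity is read off the least element of [{a, b, c}]. *)
  have [|z zabc zP] := r_min [set z | [\/ z = a, z = b | z = c]].
    by exists a; apply: Or31.
  have [za zb zc] : [/\ r z a, r z b & r z c].
    by split; apply: zP; [apply: Or31|apply: Or32|apply: Or33].
  case: zabc => z_eq; rewrite {}z_eq in za zb zc => //.
    by rewrite (r_anti a b).
  by rewrite -(r_anti b c).
exists (fun a b => r a b && (a != b)); split.
- by move=> a; rewrite eqxx andbF.
- move=> b a c /andP[ab a_b] /andP[bc b_c]; rewrite (r_trans _ _ _ ab bc).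
  by apply: contraNN b_c => /eqP ac; rewrite (r_anti b c)// -ac.
- by move=> a b ab; rewrite (eq_sym b) ab !andbT.
- move=> A /r_min[a Aa lb]; exists a => // b Ab ba.
  by rewrite lb//= eq_sym.
Qed.

Lemma well_founded_recursion (T : eqType) (lt : rel T) U
    (F : T -> (T -> U) -> U) :
  irreflexive lt -> transitive lt -> inhabited U ->
  (forall A : set T, A !=set0 -> exists2 a, A a & forall b, A b -> b != a -> lt a b) ->
  (forall a x y, (forall b, lt b a -> x b = y b) -> F a x = F a y) ->
  exists x : T -> U, forall a, x a = F a x.
Proof.
move=> lt_irr lt_trans [u0] lt_min F_ext.
have lt_wf : well_founded (fun a b => lt a b).
  move=> a0; apply: contrapT => nacc.
  have [|a na lb] := lt_min [set a | ~ Acc (fun a b => lt a b) a]; first by exists a0.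
  apply: na; constructor => b ba; apply: contrapT => nb.
  have /(lt_trans _ _ _ ba) : lt a b.
    by apply: lb => //; apply: contraTN ba => /eqP->; rewrite lt_irr.
  by rewrite lt_irr.
(* Off the predecessors of [a] the default [u0] is used; [F_ext] makes it harmless. *)
pose G a (rec : forall b, lt b a -> U) := F a (fun b =>
  if pselect (lt b a) is left ba then rec b ba else u0).
exists (Fix lt_wf (fun=> U) G) => a; rewrite Fix_eq.
  by apply: F_ext => b ba; case: pselect.
move=> b f g fg; apply: F_ext => c cb.
by case: pselect.
Qed.

(** Plays the part of the initial ordinal of [D]: the segment below the least [a] whose segment is
    at least as large as [D], or the whole type if there is no such [a]. *)
Lemma minimal_index_set (T : eqType) (lt : rel T) (D : set T) :
  irreflexive lt -> transitive lt ->
  (forall A : set T, A !=set0 -> exists2 a, A a & forall b, A b -> b != a -> lt a b) ->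
  exists2 J : set T, D #<= J & forall a, J a -> ~ (D #<= [set b | lt b a]).
Proof.
move=> lt_irr lt_trans lt_min.
have [/lt_min[a Da a_min]|small_seg] :=
    pselect ([set a | D #<= [set b | lt b a]] !=set0).
  exists [set b | lt b a] => // b /= ba Db; have /(lt_trans _ _ _ ba) : lt a b.
    by apply: a_min => //; apply: contraTN ba => /eqP->; rewrite lt_irr.
  by rewrite lt_irr.
exists [set: T] => [|a _ Da]; first exact: card_leT.
by apply: small_seg; exists a.
Qed.

Section sparse_generators.
Local Open Scope nat_scope.

(** The last three clauses serve, in turn, the failure of Menger, the infinite supports and the
    Rothberger bound. *)
Theorem sparse_generators (D : set (nat -> nat)) (pb : nat -> nat) :
  dominating_families D ->
  (forall F : set (nat -> nat), ~ (D #<= F) ->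
    exists g, forall f, F f -> le_star f g) ->
  (forall F : set (nat -> nat), ~ (D #<= F) ->
    exists g : nat -> nat, forall f, F f -> forall N, exists2 n, N <= n & g n = f n) ->
  (forall q, q <= pb q) ->
  exists (J : set (nat -> nat)) (lt : rel (nat -> nat))
         (x : (nat -> nat) -> nat -> bool),
  [/\ forall A : set (nat -> nat), A !=set0 ->
        exists2 b, A b & forall c, A c -> c != b -> lt b c,
      forall b, x b 0,
      forall g : nat -> nat, exists2 b, J b & \forall a \near \oo,
        forall c, a < c -> x b a -> x b c -> g a < c,
      forall b, exists2 h : nat -> nat,
        (forall q, exists2 j, q <= j < h q & x b j) &
        forall c, J c -> lt b c -> thin h (x c) &
      forall m : nat -> nat, exists c w (F : nat -> nat * seq (seq bool)),
        (forall b, J b -> ~~ lt b c -> thin w (x b)) /\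
        forall L : seq (nat -> nat), (forall b, b \in L -> lt b c) ->
        \forall q \near \oo, forall s, s <= pb q ->
          exists n, [/\ q <= n, F n = (s, [seq mkseq (x b) (m n) | b <- L]) &
            m n <= w q]].
Proof.
move=> D_dom bounded guessed pb_ge.
have [lt [lt_irr lt_trans lt_total lt_min]] := strict_well_order (nat -> nat).
have [J DJ J_small] := minimal_index_set D lt_irr lt_trans lt_min.
have /pcard_surjP[d d_surj] := DJ.
pose small T (S : set T) := ~ (D #<= S).
have /choice[bnd bndP] : forall F : set (nat -> nat), exists g, small _ F ->
    forall f, F f -> le_star f g.
  move=> F; have [smF|nsmF] := pselect (small _ F); last by exists id.
  by have [g gP] := bounded F smF; exists g.
have /choice[sp spP] := sparse_subset.
have /choice[next nextP] : forall y : nat -> bool, exists h : nat -> nat,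
    (forall q, exists2 j, q <= j & y j) -> forall q, exists2 j, q <= j < h q & y j.
  move=> y; have [infy|] := pselect (forall q, exists2 j, q <= j & y j).
    have /choice[h hP] : forall q, exists j, q <= j /\ y j.
      by move=> q; have [j] := infy q; exists j.
    exists (fun q => (h q).+1) => _ q; have [qh yh] := hP q.
    by exists (h q) => //; rewrite qh /=.
  by move=> ninfy; exists id.
pose w_spec (cS : (nat -> nat) * set (nat -> bool)) (w : nat -> nat) :=
  [/\ le_star (d cS.1) w,
    forall y, cS.2 y -> le_star (iter_hull (next y)) w &
    exists F : nat -> nat * seq (seq bool),
      forall L : seq (nat -> bool), (forall y, y \in L -> cS.2 y) ->
      \forall q \near \oo, forall s, s <= pb q ->
      exists n, [/\ q <= n, F n = (s, [seq mkseq y (d cS.1 n) | y <- L]) &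
        d cS.1 n <= w q]].
(* Choices are fixed in advance, as functions of the stage and the set of earlier points; the
   recursion itself is then deterministic. *)
have /choice[W WP] : forall cS : (nat -> nat) * set (nat -> bool),
    exists w : nat -> nat, small _ cS.2 -> w_spec cS w.
  move=> [c S]; have [smS|nsmS] := pselect (small _ S); last by exists id.
  have [w wP] := stage_function bounded guessed next (d c) pb_ge smS.
  by exists w.
pose Wx (x : (nat -> nat) -> nat -> bool) c := W (c, x @` [set b | lt b c]).
(* [E x b] only depends on the restriction of x to the predecessors of b. *)
pose E x b n := bnd ((iter_hull \o Wx x) @` [set c | lt c b]) n
                + iter_hull (Wx x b) n.
have Wx_ext c x y : (forall b, lt b c -> x b = y b) -> Wx x c = Wx y c.
  by move=> xy; rewrite /Wx; congr (W (_, _)); apply: eq_imagel.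
have [x xE] : exists x : (nat -> nat) -> (nat -> bool), forall b, x b = sp (E x b).
  apply: (well_founded_recursion (F := fun b x => sp (E x b)) lt_irr lt_trans _ lt_min).
    exact: inhabits (fun=> true).
  move=> b x y xy; congr sp; apply/funext => n; rewrite /E (Wx_ext b x y)//.
  congr (bnd _ n + _); apply: eq_imagel => c cb; congr iter_hull.
  by apply: Wx_ext => e ec; apply: xy; exact: lt_trans ec cb.
have x_inf b n : exists2 a, n <= a & x b a by rewrite xE; have [] := spP (E x b).
have x_sparse b a a' : x b a -> x b a' -> a < a' -> E x b a < a'.
  by rewrite xE; have [_ _] := spP (E x b); rewrite -xE; apply.
have W_spec c : J c -> w_spec (c, x @` [set b | lt b c]) (Wx x c).
  by move=> Jc; apply: WP; exact: small_image (J_small c Jc).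
(* The second summand of [E] covers [c = b], the first all [c] before [b]. *)
have hull_E c b : J b -> ~~ lt b c -> le_star (iter_hull (Wx x c)) (E x b).
  move=> Jb; have [->|cb] := eqVneq b c.
    by exists 0 => // n _; rewrite /E leq_addl.
  move=> nbc; have {}cb : lt c b by have := lt_total _ _ cb; rewrite (negbTE nbc).
  have [N _ HN] : le_star (iter_hull (Wx x c))
      (bnd ((iter_hull \o Wx x) @` [set c | lt c b])).
    by apply: bndP; [exact: small_image (J_small b Jb)|exists c].
  by exists N => // n /HN /leq_trans; apply; rewrite /E leq_addr.
have le_star_trans f g h : le_star f g -> le_star g h -> le_star f h.
  move=> [N _ fg] [M _ gh]; exists (maxn N M) => // n /=.
  by rewrite geq_max => /andP[/fg + /gh]; exact: leq_trans.
have W_E b : J b -> le_star (Wx x b) (E x b).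
  move=> Jb; apply: le_star_trans (iter_hull_ge _) _; apply: hull_E => //.
  by rewrite lt_irr.
have d_big g : exists2 c, J c & le_star g (d c).
  have [f Df gf] := D_dom g; have [c Jc dcf] := d_surj f Df.
  by exists c => //; rewrite dcf.
exists J, lt, x; split=> //.
- by move=> b; rewrite xE; have [] := spP (E x b).
- move=> g; have [b Jb gd] := d_big g; exists b => //.
  have [dW _ _] := W_spec b Jb.
  have [N _ HN] := le_star_trans _ _ _ gd (le_star_trans _ _ _ dW (W_E b Jb)).
  exists N => // a /HN gE c ac xa xc.
  by apply: leq_ltn_trans gE _; exact: x_sparse.
- move=> b; exists (next (x b)); first exact: nextP (x_inf b).
  move=> c Jc bc; have [_ nextW _] := W_spec c Jc.
  apply: thin_iter_hull (x_sparse c) (le_star_trans _ _ _ _ (W_E c Jc)).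
  by apply: nextW; exists b.
(* The stage [c] is one whose [d c] dominates [m]; its guesses are truncated from length [d c n] to
   [m n]. *)
move=> m; have [c Jc [N _ mdc]] := d_big m.
have [_ _ [F FP]] := W_spec c Jc.
exists c, (Wx x c), (fun n => ((F n).1, [seq take (m n) t | t <- (F n).2])).
split=> [b Jb bc|L Lc].
  exact: thin_iter_hull (x_sparse b) (hull_E _ _ Jb bc).
have [|M _ HM] := FP [seq x b | b <- L].
  by move=> _ /mapP[b /Lc bc ->]; exists b.
exists (maxn M N) => // q /=; rewrite geq_max => /andP[Mq Nq] s sp_q.
have [n [qn Fn dnw]] := HM q Mq s sp_q.
have mdn : m n <= d c n by apply: mdc; exact: leq_trans qn.
exists n; split=> //; last exact: leq_trans mdn dnw.
rewrite Fn /= -!map_comp; congr pair; apply: eq_map => b /=.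
exact: take_mkseq.
Qed.

End sparse_generators.

(** * Category on the real line *)

(* Near each rational q n, the integer part of 1 / (r - q n) takes all large values,
   and [logn 2] of it takes all values. *)
Lemma guess_generic (R : realType) : exists phi : R -> nat -> nat,
  forall y : nat -> nat,
    meager [set r | ~ forall N, exists2 n, (N <= n)%N & phi r n = y n].
Proof.
pose q n : R := ratr (odflt 0 (unpickle (logn 2 n))).
exists (fun r n => logn 2 `|Num.floor (r - q n)^-1|%N) => y.
exists (fun N => [set r | forall n, (N <= n)%N ->
  logn 2 `|Num.floor (r - q n)^-1|%N <> y n]); split; last first.
  apply/seteqP; split=> [r /= /existsNP[N HN]|r [N _ HN] /(_ N)[n Nn]].
    by exists N => // n Nn E; apply: HN; exists n.
  exact: HN.
move=> N; apply/seteqP; split=> // r0 /nbhs_ballP[e /= e0 r0e].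
have [x] : exists x : rat, ratr x \in `]r0, r0 + e[.
  by apply: rat_in_itvoo; rewrite ltrDl.
rewrite in_itv/= => /andP[r0x xe].
pose n := odd_part_index (pickle x) N.
have qn : q n = ratr x by rewrite /q logn_odd_part_index pickleK.
pose d := r0 + e - ratr x; have d0 : 0 < d by rewrite subr_gt0.
(* As [t] exceeds [1 / d], the interval from [x + 1/(t+1)] to [x + 1/t] ends before [r0 + e]; on it
   the integer part is [t], and [logn 2 t] is [y n]. *)
pose t := odd_part_index (y n) (Num.truncn d^-1).+1.
have td : d^-1 < t%:R.
  apply: lt_le_trans (truncnS_gt _) _; rewrite ler_nat.
  exact: odd_part_index_ge.
have t0 : 0 < t%:R :> R by apply: lt_trans td; rewrite invr_gt0.
have t1d : t%:R^-1 < d by rewrite -[d]invrK ltf_pV2 ?posrE ?invr_gt0.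
have t10 : 0 < t%:R + 1 :> R by rewrite addr_gt0.
have tt1 : (t%:R + 1)^-1 < t%:R^-1 :> R by rewrite ltf_pV2 ?posrE// ltrDl.
have [p] : exists p : rat,
    (ratr p : R) \in `]ratr x + (t%:R + 1)^-1, ratr x + t%:R^-1[.
  by apply: rat_in_itvoo; rewrite ltrD2l.
rewrite in_itv/= => /andP[tp pt].
have t1_gt0 : 0 < (t%:R + 1)^-1 :> R by rewrite invr_gt0.
have : closure [set r | forall n, (N <= n)%N ->
  logn 2 `|Num.floor (r - q n)^-1|%N <> y n] (ratr p).
  apply: r0e; rewrite /ball/= ltr_norml; move: d0 t1d tp pt t1_gt0 r0x xe.
  rewrite /d; lra.
move=> /(_ `]ratr x + (t%:R + 1)^-1, ratr x + t%:R^-1[%classic) [].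
  by apply: near_in_itvoo; rewrite in_itv/= tp pt.
move=> r [/= rN]; rewrite in_itv/= => /andP[tr rt].
apply: (rN n); first exact: odd_part_index_ge.
rewrite qn (@floor_def _ _ t%:Z) ?absz_nat ?logn_odd_part_index//.
have rx0 : 0 < r - ratr x by rewrite subr_gt0 (lt_trans _ tr)// ltrDl.
rewrite intrD -[X in X <= _]invrK -[X in _ < X]invrK.
rewrite lef_pV2 ?ltf_pV2 ?posrE ?invr_gt0//.
by rewrite lerBlDl ltrBrDl tr ltW.
Qed.

(** Each member of a family determines the meager set of reals that fail to guess it. Fewer than
    cov(M) of these do not cover the line, and a real outside them guesses the whole family. *)
Lemma guessing_principles (R : realType) :
  same_min_card (@meager_covers R) unbounded_families ->
  same_min_card unbounded_families dominating_families ->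
  exists D : set (nat -> nat), [/\ dominating_families D,
    forall F : set (nat -> nat), ~ (D #<= F) ->
      exists g, forall f, F f -> le_star f g &
    forall F : set (nat -> nat), ~ (D #<= F) -> exists g : nat -> nat,
      forall f, F f -> forall N, exists2 n, (N <= n)%N & g n = f n].
Proof.
move=> [A [C [[_ A_min] [C_unb _] AC]]] [B [D [[_ B_min] [D_dom _] BD]]].
have DB : D #<= B by rewrite (card_le_eqr BD).
exists D; split=> // F DF; apply: contrapT => nF; apply: DF.
  by apply: card_le_trans DB _; apply: B_min.
have [phi phi_meager] := guess_generic R.
(* The two hypotheses supply two unbounded families of least size, [B] and [C]. *)
apply: card_le_trans DB _; apply: card_le_trans (B_min _ C_unb) _.
rewrite -(card_le_eql AC).
apply: card_le_trans (card_image_le (fun y =>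
  [set r | ~ forall N, exists2 n, (N <= n)%N & phi r n = y n]) F).
apply: A_min; split=> [_ [y _ <-]//|].
rewrite -subTset => r _; apply: contrapT => nr; apply: nF.
exists (phi r) => y Fy; apply: contrapT => ny; apply: nr.
by exists [set r | ~ forall N, exists2 n, (N <= n)%N & phi r n = y n] => //; exists y.
Qed.

(** * Boundedness properties of groups of integer sequences *)

Section sequence_group.

Lemma initial_cvg (S : choiceType) (X : topologicalType) (f : S -> X)
    (F : set_system S) (s : S) : Filter F ->
  f x @[x --> F] --> f s -> F --> (s : initial_topology f).
Proof.
move=> FF fFs U [/= _ [[B oB <-] /= Bs sBU]]; apply: filterS sBU _.
by apply: fFs; exact: open_nbhs_nbhs.
Qed.

Lemma ptws_cvg (I : Type) (X : topologicalType) (F : set_system {ptws I -> X})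
    (f : {ptws I -> X}) : Filter F ->
  (forall i, g i @[g --> F] --> f i) -> F --> f.
Proof.
by move=> FF Ff; apply/cvg_sup => i; apply: initial_cvg; exact: Ff.
Qed.

Lemma coord_continuous (I : Type) (X : topologicalType) (i : I) :
  continuous (fun f : {ptws I -> X} => f i).
Proof.
move=> y; have /cvg_sup/(_ i) yi : y --> y by exact: cvg_id.
apply: cvg_trans (@initial_continuous _ _ (fun f : I -> X => f i) y).
exact: cvg_app.
Qed.

Lemma open_int (A : set int) : open A.
Proof.
rewrite openE => a Aa; rewrite /interior nbhs_principalE.
by apply/principal_filterP.
Qed.

Local Notation V := {ptws nat -> int}.

(** Replaces neighborhoods by moduli: convergence to 0 of the filter with base [B m] is checked one
    coordinate at a time. *)
Lemma nbhs0_power (k : nat) (G : zmodClosed V) (U : set {ptws 'I_k -> subgroup G}) :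
  nbhs 0 U -> exists m, forall u : {ptws 'I_k -> subgroup G},
    (forall i j, (j < m)%N -> (val (u i) : V) j = 0) -> U u.
Proof.
pose B m := [set u : {ptws 'I_k -> subgroup G} |
  forall i j, (j < m)%N -> (val (u i) : V) j = 0].
pose F := filter_from [set: nat] B.
have FF : Filter F.
  apply: filter_from_filter; first by exists 0%N.
  move=> m n _ _; exists (maxn m n) => // u uB.
  by split=> i j jm; apply: uB; rewrite leq_max jm ?orbT.
suff F0 : F --> (0 : {ptws 'I_k -> subgroup G}).
  by move=> /F0[m _ BU]; exists m => u; exact: BU.
apply: ptws_cvg => i; apply: initial_cvg; apply: ptws_cvg => j A /nbhs_singleton A0.
by exists j.+1 => // u /= uB; rewrite /= uB.
Qed.

(** A guess need not lie in the group: it is replaced by a tuple of group elements agreeing with it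
    below [m n], or by 0 if there is none. *)
Lemma rothberger_bounded_power (k : nat) (G : zmodClosed V) :
  (forall m : nat -> nat, exists a : nat -> 'I_k -> nat -> int,
    forall g : 'I_k -> V, (forall i, g i \in G) ->
    exists n, forall i j, (j < m n)%N -> g i j = a n i j) ->
  rothberger_bounded {ptws 'I_k -> subgroup G}.
Proof.
move=> guessG U /(_ _)/nbhs0_power-/choice[m mU].
have [a aP] := guessG m.
pose agree n (b g : {ptws 'I_k -> subgroup G}) :=
  forall i j, (j < m n)%N -> (val (b i) : V) j = (val (g i) : V) j.
have /choice[b bP] : forall n, exists b : {ptws 'I_k -> subgroup G},
    forall g : {ptws 'I_k -> subgroup G},
    (forall i j, (j < m n)%N -> (val (g i) : V) j = a n i j) -> agree n b g.
  move=> n; have [[b ba]|nb] := pselect (exists b : {ptws 'I_k -> subgroup G},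
      forall i j, (j < m n)%N -> (val (b i) : V) j = a n i j).
    by exists b => g ga i j jm; rewrite ba// ga.
  by exists 0 => g ga; exfalso; apply: nb; exists g.
exists b; apply/esym; rewrite -subTset => g _.
have [n an] := aP (fun i => val (g i)) (fun i => valP (g i)).
exists n => //; exists (g - b n); last by rewrite addrC subrK.
apply: mU => i j jm.
have -> : (val ((g - b n) i) : V) j = (val (g i) : V) j - (val (b n i) : V) j by [].
by rewrite (bP n g an i j jm) subrr.
Qed.

Definition bounded_seq : {pred V} :=
  fun z => `[< exists b : nat, forall n, (`|z n|%N <= b)%N >].

Lemma bounded_seq_zmod : zmod_closed bounded_seq.
Proof.
split=> [|y z /asboolP[b yb] /asboolP[c zc]]; first by apply/asboolP; exists 0%N.
apply/asboolP; exists (b + c)%N => n.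
have -> : (y - z) n = y n - z n by [].
by have := yb n; have := zc n; lia.
Qed.
HB.instance Definition _ := GRing.isZmodClosed.Build V bounded_seq bounded_seq_zmod.

(** The sequences with a fixed bound form a product of finite sets, compact by Tychonoff. *)
Lemma sigma_compact_bounded_seq : sigma_compact [set z | z \in bounded_seq].
Proof.
exists (fun b => [set z : V | forall n, [set c : int | (`|c|%N <= b)%N] (z n)]).
split=> [b|]; last first.
  by apply/seteqP; split=> [z /asboolP[b zb]|z [b _ zb]]; [exists b|apply/asboolP; exists b].
apply: (@tychonoff nat (fun=> int) (fun=> [set c : int | (`|c|%N <= b)%N])) => _.
apply: finite_compact.
apply: (sub_finite_set (B := (fun i : 'I_b.+1 * bool =>
  (-1) ^+ i.2 * (i.1 : nat)%:Z) @` setT)); last exact: finite_image.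
move=> c /= cb; have cb' : (`|c| < b.+1)%N by [].
exists (Ordinal cb', c < 0) => //=.
by rewrite mulr_sign_norm.
Qed.

(** One representative is taken for each realized pattern below [m n] with entries of absolute value
    at most [n]; a bounded tuple has such a pattern once [n] reaches its bound. *)
Lemma hurewicz_bounded_power (k : nat) (G : zmodClosed V) :
  {subset G <= bounded_seq} -> hurewicz_bounded {ptws 'I_k -> subgroup G}.
Proof.
move=> GH U /(_ _)/nbhs0_power-/choice[m mU].
pose agree n (b g : {ptws 'I_k -> subgroup G}) :=
  forall i j, (j < m n)%N -> (val (b i) : V) j = (val (g i) : V) j.
pose pattern n := {ffun 'I_k * 'I_(m n) -> 'I_n.+1 * bool}.
pose has_pattern n (t : pattern n) (g : {ptws 'I_k -> subgroup G}) :=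
  forall i (j : 'I_(m n)), (val (g i) : V) j = (-1) ^+ (t (i, j)).2 * ((t (i, j)).1 : nat)%:Z.
have /choice[b bP] : forall nt : {n & pattern n}, exists b : {ptws 'I_k -> subgroup G},
    forall g, has_pattern _ (projT2 nt) g -> agree (projT1 nt) b g.
  move=> [n t] /=; have [[b bt]|nb] := pselect (exists b, has_pattern n t b).
    by exists b => g gt i j jm; rewrite (bt i (Ordinal jm)) -(gt i (Ordinal jm)).
  by exists 0 => g gt; exfalso; apply: nb; exists g.
exists (fun n => (fun t : pattern n => b (existT _ n t)) @` setT); split.
  by move=> n; apply: finite_image; exact: finite_finset.
move=> g.
have /choice[c cP] : forall i, exists c : nat, forall j, (`|(val (g i) : V) j|%N <= c)%N.
  by move=> i; have /GH/asboolP[c] := valP (g i); exists c.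
exists (\max_i c i) => // n /= cn.
have gn i j : (`|(val (g i) : V) j|%N < n.+1)%N.
  by rewrite ltnS (leq_trans (cP i j))// (leq_trans _ cn)//; exact: leq_bigmax.
pose t : pattern n := [ffun ij : 'I_k * 'I_(m n) =>
  (Ordinal (gn ij.1 ij.2), (val (g ij.1) : V) ij.2 < 0)].
have gt : has_pattern n t g by move=> i j; rewrite ffunE/= mulr_sign_norm.
exists (b (existT _ n t)); first by exists t.
exists (g - b (existT _ n t)); last by rewrite addrC subrK.
apply: mU => i j jm; set bt := b _.
have -> : (val ((g - bt) i) : V) j = (val (g i) : V) j - (val (bt i) : V) j by [].
by rewrite (bP (existT _ n t) g gt i j jm) subrr.
Qed.

Lemma not_menger_subgroup (G : zmodClosed V) :
  (forall z, z \in G -> z 0%N != 0 -> forall N, exists2 n, (N <= n)%N & z n != 0) ->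
  (forall g : nat -> nat, exists2 z, z \in G & z 0%N != 0 /\
    \forall a \near \oo, forall c, (a < c)%N -> z a != 0 -> z c != 0 -> (g a < c)%N) ->
  ~ menger (subgroup G).
Proof.
move=> infG sparseG mengerG.
(* The case of value 0 at coordinate 0 puts the zero sequence into every set. *)
pose W n m := [set z : subgroup G | (val z : V) 0%N = 0 \/
  exists a c, [/\ (n <= a)%N, (a < c)%N, (c <= m)%N & (val z : V) a != 0 /\ (val z : V) c != 0]].
have val_cont j : continuous (fun z : subgroup G => (val z : V) j).
  move=> z; apply: (@continuous_comp _ _ _ (val : subgroup G -> V) (fun f : V => f j)).
    exact: (@initial_continuous _ _ (val : subgroup G -> V)).
  exact: coord_continuous.
have coord_open j (A : set int) : open [set z : subgroup G | A ((val z : V) j)].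
  by move/continuousP: (val_cont j) => /(_ A); apply; exact: open_int.
have W_open n m : open (W n m).
  have -> : W n m = [set z : subgroup G | (val z : V) 0%N = 0] `|`
      \bigcup_(ac in [set ac : nat * nat | [/\ n <= ac.1, ac.1 < ac.2 & ac.2 <= m]%N])
      ([set z : subgroup G | (val z : V) ac.1 != 0] `&` [set z | (val z : V) ac.2 != 0]).
    apply/seteqP; split=> z [z0|]; [by left| |by left|].
      by move=> [a [c [na ac cm zac]]]; right; exists (a, c).
    by move=> [[a c] /= [na ac cm] zac]; right; exists a, c.
  apply: openU; first exact: (coord_open 0%N [set 0]).
  apply: bigcup_open => -[a c] _ /=; apply: openI.
    exact: (coord_open a [set x | x != 0]).
  exact: (coord_open c [set x | x != 0]).
have W_cover n : open_cover (range (W n)).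
  split=> [_ [m _ <-]//|]; rewrite -subTset => z _.
  have [z0|z0] := eqVneq ((val z : V) 0%N) 0.
    by exists (W n 0%N); [exists 0%N|left].
  have [a na za] := infG _ (valP z) z0 n.
  have [c ac zc] := infG _ (valP z) z0 a.+1.
  by exists (W n c); [exists c|right; exists a, c].
have W_mono n m m' : (m <= m')%N -> W n m `<=` W n m'.
  move=> mm' z [z0|[a [c [na ac cm zac]]]]; first by left.
  by right; exists a, c; split=> //; exact: leq_trans mm'.
(* Menger is applied for every shift [N], since a sparse element obeys its gap bound only from an
   unknown point on. *)
have /choice[f fP] : forall N, exists f : nat -> nat,
    forall z : subgroup G, exists n, W (n + N)%N (f n) z.
  move=> N; have [F [FP F_cover]] := mengerG (fun n => range (W (n + N)%N)) (fun n => W_cover _).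
  have /choice[f fP] : forall n, exists b, forall A, F n A -> A `<=` W (n + N)%N b.
    move=> n; have [finF FW] := FP n.
    have /choice[bA bAP] : forall A, exists b, F n A -> A = W (n + N)%N b.
      move=> A; have [/FW[b _ <-]|nFA] := pselect (F n A); first by exists b.
      by exists 0%N.
    have /finite_seqP[s Fs] := finF.
    exists (\max_(A <- s) bA A) => A FA; rewrite {1}(bAP A FA); apply: W_mono.
    by apply: leq_bigmax_seq => //; move: FA; rewrite Fs.
  exists f => z; have : (\bigcup_n \bigcup_(V in F n) V) z by rewrite F_cover.
  by move=> [n _ [A FA Az]]; exists n; exact: fP Az.
(* If [a] is at least [N] and [n], then [g a] is at least [f N n]; so two points [a < c <= f N n]
   contradict sparseness. *)
pose g n := (\sum_(N < n.+1) \sum_(i < n.+1) f N i)%N.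
have [z zG [z0 [N _ zN]]] := sparseG g.
have [n] := fP N (Sub z zG).
rewrite /W /= => -[/eqP|[a [c [na ac cf [za zc]]]]]; first by rewrite (negbTE z0).
have := zN a (leq_trans (leq_addl _ _) na) c ac za zc.
rewrite ltnNge => /negP; apply; apply: leq_trans cf _.
have Na : (N < a.+1)%N by rewrite ltnS (leq_trans (leq_addl _ _) na).
have na' : (n < a.+1)%N by rewrite ltnS (leq_trans (leq_addr _ _) na).
rewrite /g (bigD1 (Ordinal Na))//= (bigD1 (Ordinal na'))//= -addnA.
exact: leq_addr.
Qed.

End sequence_group.

(** * The group generated by the sparse points *)

(** Bounds the free parameter of the guesses, which will code coefficients and the late generators
    below a gap starting at [q]: finitely many data for each [q]. *)
Lemma code_bound : exists pb : nat -> nat, (forall q, (q <= pb q)%N) /\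
  forall q j (t : seq (seq bool)), (j <= q)%N -> (size t <= q)%N ->
    all (fun v => size v == q) t -> (pickle (j, t) <= pb q)%N.
Proof.
exists (fun q => q + \max_(j < q.+1) \max_(l < q.+1)
  \max_(t : l.-tuple (q.-tuple bool)) pickle (j : nat, [seq val v | v <- t]))%N.
split=> [q|q j t jq tq t_size]; first exact: leq_addr.
pose t' : (size t).-tuple (q.-tuple bool) :=
  [tuple of [seq insubd [tuple of nseq q false] v | v <- in_tuple t]].
have <- : [seq val v | v <- t'] = t.
  rewrite -map_comp -[RHS]map_id; apply/eq_in_map => v /(allP t_size) vq /=.
  by rewrite val_insubd vq.
apply: leq_trans (leq_addl _ _).
apply: leq_trans (leq_bigmax (Ordinal (jq : j < q.+1)%N)).
apply: leq_trans (leq_bigmax (Ordinal (tq : size t < q.+1)%N)).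
exact: (leq_bigmax t').
Qed.

Section integer_span.
Variables (T : eqType) (J : set T) (x : T -> nat -> bool).
Local Notation V := {ptws nat -> int}.

Definition combination (L : seq (T * int)) : V :=
  fun n => \sum_(p <- L) p.2 *+ x p.1 n.

Definition integer_span : {pred V} := fun z =>
  `[< exists2 L, (forall p, p \in L -> J p.1) & z = combination L >].

Lemma integer_span_zmod : zmod_closed integer_span.
Proof.
split=> [|y z /asboolP[L LJ ->] /asboolP[M MJ ->]]; apply/asboolP.
  by exists [::] => //; apply/funext => n; rewrite /combination big_nil.
exists (L ++ [seq (p.1, - p.2) | p <- M]) => [p|].
  by rewrite mem_cat => /orP[/LJ//|/mapP[p' /MJ + ->]].
apply/funext => n; transitivity (combination L n - combination M n) => //.
rewrite /combination big_cat big_map/= -sumrN; congr (_ + _).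
by apply: eq_bigr => p _; rewrite mulNrn.
Qed.
HB.instance Definition _ := GRing.isZmodClosed.Build V integer_span integer_span_zmod.

Lemma integer_span_bounded : {subset integer_span <= bounded_seq}.
Proof.
move=> _ /asboolP[L _ ->]; apply/asboolP; exists (\sum_(p <- L) `|p.2|)%N => n.
rewrite /combination; elim: L => [|p L IH]; first by rewrite !big_nil.
have absD (a b : int) : (`|(a + b)%R| <= `|a| + `|b|)%N by lia.
rewrite !big_cons (leq_trans (absD _ _))// leq_add//.
by case: (x p.1 n); rewrite ?mulr1n ?mulr0n.
Qed.

(** Collects the coefficients of repeated generators, so that cancellation between them is accounted
    for. *)
Lemma combination_undup L n : combination L n =
  \sum_(b <- undup [seq p.1 | p <- L]) (\sum_(p <- L | p.1 == b) p.2) *+ x b n.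
Proof.
rewrite /combination; under [RHS]eq_bigr do rewrite -sumrMnl.
rewrite (exchange_big_dep xpredT)//=; apply: eq_big_seq => p pL.
rewrite (big_rem p.1) /=; last by rewrite mem_undup map_f.
rewrite eqxx big1_seq ?addr0// => b /andP[/eqP <-].
by rewrite mem_rem_uniq ?undup_uniq// inE eqxx.
Qed.

(** Let [b] be the earliest generator with nonzero total coefficient. At its point in a gap common
    to the others, [z] equals that coefficient; one iteration of the hull suffices, being at least
    [h]. *)
Lemma integer_span_infinite (lt : rel T) :
  (forall A : set T, A !=set0 ->
     exists2 b, A b & forall c, A c -> c != b -> lt b c) ->
  (forall b, exists2 h : nat -> nat,
     (forall q, exists2 j, (q <= j < h q)%N & x b j) &
     forall c, J c -> lt b c -> thin h (x c)) ->
  forall z n0, z \in integer_span -> z n0 != 0 ->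
  forall N, exists2 n, (N <= n)%N & z n != 0.
Proof.
move=> lt_min nextP z n0 /asboolP[L LJ ->] zn0 N.
pose U := undup [seq p.1 | p <- L]; pose C b := \sum_(p <- L | p.1 == b) p.2.
have [|b [bU Cb] b_min] := lt_min [set b | b \in U /\ C b != 0].
  apply: contrapT => noU; move/negP: zn0; apply; apply/eqP.
  rewrite combination_undup big1_seq// => b /andP[_ bU].
  rewrite -/(C b); have [->|Cb] := eqVneq (C b) 0; first by rewrite mul0rn.
  by exfalso; apply: noU; exists b.
have [h h_next h_thin] := nextP b.
have [|q Nq gap] := common_gap
    (h := h) (L := [seq x c | c <- U & (C c != 0) && (c != b)]) _ 1 N.
  move=> _ /mapP[c + ->]; rewrite mem_filter => /andP[/andP[Cc cb] cU].
  apply: h_thin; last exact: b_min.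
  by move: cU; rewrite mem_undup => /mapP[p /LJ + ->].
have [j /andP[qj jh] xj] := h_next q.
exists j; first exact: leq_trans qj.
rewrite combination_undup (big_rem b)//= xj [X in _ + X]big1_seq ?addr0//.
move=> c /andP[_].
rewrite mem_rem_uniq ?undup_uniq// inE => /andP[cb cU].
rewrite -/(C c); have [->|Cc] := eqVneq (C c) 0; first by rewrite mul0rn.
rewrite (_ : x c j = false) ?mulr0n//; apply/negbTE/gap.
  by apply/mapP; exists c; rewrite // mem_filter Cc cb.
by rewrite qj (leq_trans jh)//; exact: nondec_hull_ge.
Qed.

(** One list with vector coefficients serves all coordinates, so a power is guessed like the group
    itself. *)
Lemma integer_span_tuple k (g : 'I_k -> V) : (forall i, g i \in integer_span) ->
  exists2 L : seq (T * {ffun 'I_k -> int}), (forall p, p \in L -> J p.1) &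
    forall i n, g i n = \sum_(p <- L) p.2 i *+ x p.1 n.
Proof.
move=> gJ.
have /choice[L LP] : forall i, exists L, (forall p, p \in L -> J p.1) /\ g i = combination L.
  by move=> i; have /asboolP[L] := gJ i; exists L.
exists (flatten [seq [seq (p.1, [ffun i' => if i' == i then p.2 else 0]) | p <- L i] | i : 'I_k]).
  by move=> p /flatten_imageP[i _ /mapP[p' /(LP i).1 + ->]].
move=> i n; rewrite (LP i).2 big_flatten/= big_image/= (bigD1 i)//= big_map.
rewrite [X in _ = _ + X]big1 ?addr0 => [|i' i'i].
  by apply: eq_bigr => p _; rewrite ffunE eqxx.
rewrite big_map big1// => p _; rewrite ffunE eq_sym (negbTE i'i); exact: mul0rn.
Qed.

Lemma integer_span_rothberger (lt : rel T) (pb : nat -> nat) (k : nat) :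
  (forall q j (t : seq (seq bool)), (j <= q)%N -> (size t <= q)%N ->
    all (fun v => size v == q) t -> (pickle (j, t) <= pb q)%N) ->
  (forall m : nat -> nat, exists c w (F : nat -> nat * seq (seq bool)),
    (forall b, J b -> ~~ lt b c -> thin w (x b)) /\
    forall L : seq T, (forall b, b \in L -> lt b c) ->
    \forall q \near \oo, forall s, (s <= pb q)%N ->
      exists n, [/\ (q <= n)%N, F n = (s, [seq mkseq (x b) (m n) | b <- L]) &
        (m n <= w q)%N]) ->
  rothberger_bounded {ptws 'I_k -> subgroup integer_span}.
Proof.
move=> pbP guessP; apply: rothberger_bounded_power => m.
have [c [w [F [w_thin FP]]]] := guessP m.
pose coefs : countType := (seq {ffun 'I_k -> int} * seq {ffun 'I_k -> int})%type.
have [dec decK] : exists dec : nat -> nat * seq (seq bool), cancel pickle dec.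
  by exists (fun s => odflt (0%N, [::]) (unpickle s)) => t; rewrite pickleK.
have [dec' dec'K] : exists dec : nat -> coefs, cancel pickle dec.
  by exists (fun s => odflt ([::], [::]) (unpickle s)) => t; rewrite pickleK.
(* The parameter s codes the coefficients, together with the restrictions to
   [0, q) of the generators at or after stage c. *)
pose dot (cs : seq {ffun 'I_k -> int}) (t : seq (seq bool)) i j :=
  \sum_(p <- zip cs t) p.1 i *+ nth false p.2 j.
exists (fun n i j => let: (e, t) := dec (F n).1 in
  dot (dec' e).1 (F n).2 i j + dot (dec' e).2 t i j).
move=> g /integer_span_tuple[L LJ gL].
pose Ls := [seq p <- L | lt p.1 c]; pose Ll := [seq p <- L | ~~ lt p.1 c].
pose e := pickle (([seq p.2 | p <- Ls], [seq p.2 | p <- Ll]) : coefs).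
have [|N _ HN] := FP [seq p.1 | p <- Ls].
  by move=> b /mapP[p]; rewrite mem_filter => /andP[+ _] ->.
(* The gap starts late enough for [F] to be correct, and for the code [e] and the number of late
   generators to be at most [q], as [pbP] asks. *)
have [|q] := common_gap (h := w) (L := [seq x p.1 | p <- Ll]) _ 1 (maxn N (maxn e (size Ll))).
  move=> _ /mapP[p + ->]; rewrite mem_filter => /andP[pc pL].
  by apply: w_thin => //; exact: LJ.
rewrite !geq_max => /and3P[Nq eq_ Lq] gap.
pose t := [seq mkseq (x p.1) q | p <- Ll].
have [|n [qn Fn mnw]] := HN q Nq (pickle (e, t)).
  apply: pbP; rewrite ?size_map//.
  by apply/allP => _ /mapP[p _ ->]; rewrite size_mkseq.
exists n => i j jm; rewrite Fn decK dec'K /dot/= -!map_comp !zip_map !big_map.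
rewrite gL (bigID (fun p => lt p.1 c))/=.
rewrite -[X in X + _ = _]big_filter -[X in _ + X = _]big_filter -/Ls -/Ll; congr (_ + _).
  by apply: eq_bigr => p _; rewrite /= nth_mkseq.
apply: eq_big_seq => p pL /=.
have [jq|qj] := ltnP j q; first by rewrite nth_mkseq.
(* The coded strings have length [q]; past it [nth] returns [false], the value of the late
   generators in the gap. *)
rewrite nth_default ?size_mkseq// (_ : x p.1 j = false)//; apply/negbTE/gap.
  by apply/mapP; exists p.
rewrite qj (leq_trans jm)// (leq_trans mnw)//; exact: nondec_hull_ge.
Qed.

End integer_span.

Theorem theorem8p5 (R : realType) :
  same_min_card (@meager_covers R) unbounded_families ->
  same_min_card unbounded_families dominating_families ->
  exists H G : zmodClosed {ptws nat -> int},
    [/\ sigma_compact [set x | x \in H],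
        {subset G <= H},
        forall k : nat,
          rothberger_bounded {ptws 'I_k -> subgroup G} /\
          hurewicz_bounded {ptws 'I_k -> subgroup G} &
        ~ menger (subgroup G)].
Proof.
move=> covM_b b_d.
have [D [D_dom bounded guessed]] := guessing_principles covM_b b_d.
have [pb [pb_ge pbP]] := code_bound.
have [J [lt [x [lt_min x_0 x_dom x_next x_guess]]]] :=
  sparse_generators D_dom bounded guessed pb_ge.
exists (bounded_seq : zmodClosed _), (integer_span J x : zmodClosed _); split.
- exact: sigma_compact_bounded_seq.
- exact: integer_span_bounded.
- move=> k; split; first exact: integer_span_rothberger pbP x_guess.
  by apply: hurewicz_bounded_power; exact: integer_span_bounded.
apply: not_menger_subgroup => [z zG z0|g].
  exact: integer_span_infinite lt_min x_next z 0%N zG z0.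
have [b Jb [N _ bN]] := x_dom g.
exists (combination x [:: (b, 1)]).
  by apply/asboolP; exists [:: (b, 1)] => // p; rewrite inE => /eqP->.
have combE n : combination x [:: (b, 1)] n = (x b n)%:Z.
  by rewrite /combination big_seq1 /= -[RHS]natz.
split; first by rewrite combE x_0.
exists N => // a /bN xab c ac; rewrite !combE => xa xc.
by apply: xab ac _ _; [case: (x b a) xa|case: (x b c) xc].
Qed.
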